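(* Every right-alignable increasing tableau of straight shape is a unique rectification target (URT).
   Context: $\mathbb{N}$ is the set of positive integers. A box is an element $(i,j)\in\mathbb{N}\times\mathbb{N}$ (row $i$, column $j$, rows numbered downward); $(i,j)$ is weakly northwest of $(i',j')$ if $i\le i'$ and $j\le j'$. A shape is a finite subset of $\mathbb{N}\times\mathbb{N}$. A straight shape is a shape containing with each box all boxes weakly northwest of it; it is identified with the partition $(\lambda_1,\dots,\lambda_\ell)$ of its row lengths. A filling of a shape $\lambda$ is a map $T:\lambda\to\mathbb{N}$; it is increasing if $T(\alpha)<T(\beta)$ whenever $\alpha\ne\beta$ and $\alpha$ is weakly northwest of $\beta$. An increasing tableau of straight shape is an increasing filling of a straight shape. ''Tableau'' means increasing tableau of straight shape. Right alignment. For a straight shape $\lambda=(\lambda_1,\dots,\lambda_\ell)$, let $\lambda_R=\{(i,j): 1\le i\le \ell,\ \lambda_1-\lambda_i<j\le\lambda_1\}$. For a tableau $T$ of shape $\lambda$, its right alignment is the filling $T_R:\lambda_R\to\mathbb{N}$, $T_R(i,j)=T(i,j-\lambda_1+\lambda_i)$. $T$ is right-alignable if $T_R$ is an increasing filling. $K$-Knuth equivalence. On words in $\mathbb{N}$, $\equiv$ is the equivalence relation generated by the following replacements of consecutive letters: $xzy\equiv zxy$ $(x<y<z)$; $yxz\equiv yzx$ $(x<y<z)$; $x\equiv xx$; $xyx\equiv yxy$. The row word $\mathrm{row}(T)$ reads the entries of $T$ left to right along each row, from the bottom row to the top row. Tableaux $T,T'$ are $K$-Knuth equivalent, $T\equiv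 T'$, if $\mathrm{row}(T)\equiv\mathrm{row}(T')$. URT. A tableau $T$ is a unique rectification target if it is the only tableau (of straight shape) in its $K$-Knuth equivalence class, i.e. $T'\equiv T$ with $T'$ a tableau implies $T'=T$. *)

(* Defs.v *)
From Stdlib Require Import Relations.
From mathcomp Require Import all_boot.
From mathcomp Require Import finmap.

Set Implicit Arguments.
Unset Strict Implicit.
Unset Printing Implicit Defensive.

Local Open Scope fset_scope.
Local Open Scope fmap_scope.
Local Open Scope nat_scope.

(* Boxes, entries and letters are positive integers, represented in [nat];
   positivity is part of [is_shape] and [is_filling]. *)
Definition box : Type := nat * nat.
Definition shape : Type := {fset nat * nat}.
Definition filling : Type := {fmap nat * nat -> nat}.

Definition northwest (a b : box) : Prop := (a.1 <= b.1) /\ (a.2 <= b.2).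

Definition is_box (b : box) : Prop := (0 < b.1) /\ (0 < b.2).

Definition is_shape (s : shape) : Prop := forall b, b \in s -> is_box b.

Definition straight (s : shape) : Prop :=
  is_shape s /\
  forall a b, is_box a -> b \in s -> northwest a b -> a \in s.

(* The parts lambda_i and the number l of parts of a straight shape. *)
Definition row_length (s : shape) (i : nat) : nat :=
  #|` [fset b in s | b.1 == i]|.
Definition nrows (s : shape) : nat := #|` [fset b.1 | b in s]|.

(* The default 0 is taken only outside the shape of [T]. *)
Definition entry (T : filling) (b : box) : nat := odflt 0 T.[? b].

Definition is_filling (T : filling) : Prop :=
  is_shape (domf T) /\ forall b, b \in domf T -> 0 < entry T b.

Definition increasing (T : filling) : Prop :=
  is_filling T /\
  forall a b, a \in domf T -> b \in domf T ->
    a <> b -> northwest a b -> entry T a < entry T b.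

Definition tableau (T : filling) : Prop :=
  straight (domf T) /\ increasing T.

(* For a straight shape, row i occupies the columns j with
   lambda_1 - lambda_i < j <= lambda_1. *)
Definition right_shape (s : shape) : shape :=
  [fset b in [seq (i, j) | i <- iota 1 (nrows s),
                           j <- iota (row_length s 1 - row_length s i).+1
                                     (row_length s i)]].

(* [j + lambda_i - lambda_1] is exact on the boxes of [right_shape]. *)
Definition right_alignment (T : filling) : filling :=
  [fmap b : right_shape (domf T) =>
     entry T ((val b).1,
              (val b).2 + row_length (domf T) (val b).1
                        - row_length (domf T) 1)].

Definition right_alignable (T : filling) : Prop :=
  increasing (right_alignment T).

Definition word : Type := seq nat.

(* Every replacement preserves the set of letters, so a word in positive
   letters is only ever related to words in positive letters. *)
Inductive kknuth_step : word -> word -> Prop :=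
| KK_xzy u v x y z : x < y -> y < z ->
    kknuth_step (u ++ [:: x; z; y] ++ v) (u ++ [:: z; x; y] ++ v)
| KK_yxz u v x y z : x < y -> y < z ->
    kknuth_step (u ++ [:: y; x; z] ++ v) (u ++ [:: y; z; x] ++ v)
| KK_idem u v x :
    kknuth_step (u ++ [:: x] ++ v) (u ++ [:: x; x] ++ v)
| KK_braid u v x y :
    kknuth_step (u ++ [:: x; y; x] ++ v) (u ++ [:: y; x; y] ++ v).

Definition kknuth_word : word -> word -> Prop :=
  clos_refl_sym_trans word kknuth_step.

(* Meaningful for fillings of straight shapes. *)
Definition row_word (T : filling) : word :=
  flatten [seq [seq entry T (i, j) | j <- iota 1 (row_length (domf T) i)]
          | i <- rev (iota 1 (nrows (domf T)))].

Definition kknuth (T T' : filling) : Prop :=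
  kknuth_word (row_word T) (row_word T').

Definition URT (T : filling) : Prop :=
  tableau T /\ forall T' : filling, tableau T' -> kknuth T' T -> T' = T.

(* Main.v *)
(* The entries of the right alignment, read off along the boxes of lambda_R in
   any order in which a box comes after all boxes weakly southwest of it (a
   linear extension; repeated readings of the same box are allowed as long as
   the condition holds for all of them), form a set of words that contains
   row(T).  This set is closed under every K-Knuth move, in both directions:
   right-alignability says that two boxes in northwest position have increasing
   entries, and every other pair of distinct boxes spans a rectangle inside
   lambda_R that must be read between them, which leaves no room for a bad
   move.  Finally, if the row word of a tableau T' is such a reading, then row
   by row from the top the boxes read along row i of T' are exactly those of
   row i of lambda_R, so that T' and T have the same rows. *)
From mathcomp Require Import all_boot finmap zify.
Require Import Defs.

Set Implicit Arguments.
Unset Strict Implicit.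
Unset Printing Implicit Defensive.

(** * Readings of a set of boxes *)

Definition southwest (p q : box) : bool := (q.1 <= p.1) && (p.2 <= q.2).

Definition reading_order (p q : box) : bool := (p == q) || ~~ southwest q p.

Definition reading (B : pred box) (b : seq box) : Prop :=
  b =i B /\ pairwise reading_order b.

Definition readable (B : pred box) (f : box -> nat) (w : word) : Prop :=
  exists2 b, reading B b & map f b = w.

(** Order-convexity for [southwest]: with two comparable boxes, the other two corners of the
    rectangle they span are in [B]. *)
Definition sw_convex (B : pred box) : Prop :=
  forall p q r, p \in B -> q \in B ->
    southwest p r -> southwest r q -> r \in B.

Definition nw_increasing (B : pred box) (f : box -> nat) : Prop :=
  forall p q, p \in B -> q \in B -> p <> q -> northwest p q -> f p < f q.

Lemma pairwise_swap (S : Type) (R : rel S) (u v : seq S) p q :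
  R q p -> pairwise R (u ++ p :: q :: v) -> pairwise R (u ++ q :: p :: v).
Proof.
move=> Rqp; rewrite !pairwise_cat !allrel_consr /= Rqp.
by case/and3P=> /and3P[-> -> ->] -> /andP[/andP[_ ->] /andP[-> ->]].
Qed.

(** An occurrence of [s] before [p] or after [r] violates the reading order, unless [s] is [p] or
    [r] itself. *)
Lemma reading_between B u m v p r s :
  reading B (u ++ p :: m ++ r :: v) -> s \in B ->
  southwest p s -> southwest s r -> s \in p :: rcons m r.
Proof.
have -> : u ++ p :: m ++ r :: v = u ++ (p :: rcons m r) ++ v.
  by rewrite /= cat_rcons.
case=> memB.
rewrite -memB !mem_cat !pairwise_cat allrel_catr.
case/and3P=> /andP[Rl _] _ /and3P[Rr _ _] /or3P[su|//|sv] ps sr.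
- have /(allrelP Rl _ _ su): p \in p :: rcons m r by rewrite inE eqxx.
  by rewrite /reading_order ps orbF => /eqP ->; rewrite inE eqxx.
- have r_in : r \in p :: rcons m r by rewrite inE mem_rcons inE eqxx orbT.
  have:= allrelP Rr _ _ r_in sv.
  by rewrite /reading_order sr orbF => /eqP <-.
Qed.

(** * Constraints on boxes that are read close to each other *)

Lemma nw_increasing_le B f p q :
  nw_increasing B f -> p \in B -> q \in B ->
  p.1 <= q.1 -> p.2 <= q.2 -> f p <= f q.
Proof.
move=> fB pB qB le1 le2; have [->//|/eqP neq_pq] := eqVneq p q.
by rewrite ltnW ?fB.
Qed.

(** Symmetric in [x] and [y], so that one argument serves both directions of a Knuth move. *)
Definition strictly_between (x y z : nat) : bool :=
  (x < z < y) || (y < z < x).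

Lemma reading_triple B u v p q r :
  reading B (u ++ [:: p; q; r] ++ v) ->
  [/\ p \in B, q \in B & r \in B] /\
  [/\ reading_order p q, reading_order p r & reading_order q r].
Proof.
case=> memB; rewrite 2!pairwise_cat /= !andbT.
case/and4P=> _ _ _ /andP[/andP[/andP[-> ->] ->] _].
by rewrite -!memB !mem_cat !inE !eqxx !orbT.
Qed.

(* If p and q were related by the north-east order they would be neighbours in
   a row or a column of B; as the value at r lies between theirs, r sits so that
   the fourth corner of the rectangle spanned by p, q and r must be read between
   them, where there is no room for it. *)
Lemma reading_swap_before B f u v p q r :
  sw_convex B -> nw_increasing B f ->
  reading B (u ++ [:: p; q; r] ++ v) -> strictly_between (f p) (f q) (f r) ->
  reading_order q p.
Proof.
move=> Bc fB bB fr; rewrite /reading_order.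
have [<-//|/eqP neq_qp] /= := eqVneq; apply/negP=> pq.
have [[pB qB rB] [_ _]] := reading_triple bB.
have bpq s := reading_between (m := [::]) (v := r :: v) (s := s) bB.
have bpr s := reading_between (m := [:: q]) (v := v) (s := s) bB.
have le x y := @nw_increasing_le B f x y fB.
have corner x y s :
  x \in B -> y \in B -> southwest x s -> southwest s y -> s \in B.
  exact: Bc.
rewrite /reading_order; have [eq_qr|/eqP neq_qr /= nrq] := eqVneq q r.
  by move: fr; rewrite eq_qr /strictly_between; lia.
case: p q r => [i j] [i' j'] [k l]
  in pB qB rB bpq bpr fr neq_qp pq neq_qr nrq {bB} *.
rewrite /southwest /= in pq nrq bpq bpr corner le.
(* The corner [(i, j')] has to be read between the adjacent [p] and [q], so it is one of them: they
   share a row or a column. *)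
have ij' : (i, j') \in B by apply: corner pB qB _ _ => /=; lia.
have := bpq _ ij'; rewrite !inE /= !xpair_eqE => bpq'.
have := le _ _ pB rB; have := le _ _ rB pB.
have := le _ _ qB rB; have := le _ _ rB qB.
have := le _ _ pB qB; have := le _ _ qB pB => /=.
rewrite /strictly_between in fr.
(* In both cases the value at [r] and its place after [q] force [r] strictly northeast of [p]. The
   corner of their rectangle that is off the common row or column of [p] and [q] then has no
   place. *)
have [eqi|neqi] := eqVneq i i'.
- subst i'; have [lt_jl|] := leqP j l; last by lia.
  have [lt_ki|] := ltnP k i; last by lia.
  have kj : (k, j) \in B by apply: corner pB rB _ _ => /=; lia.
  by have := bpr _ kj; rewrite !inE /= !xpair_eqE; lia.
- have eqj : j = j' by lia.
  subst j'; have [lt_jl|] := ltnP j l; last by lia.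
  have [le_ki|] := leqP k i; last by lia.
  have il : (i, l) \in B by apply: corner pB rB _ _ => /=; lia.
  by have := bpr _ il; rewrite !inE /= !xpair_eqE; lia.
Qed.

(** Mirror image of [reading_swap_before]: [p] and [q] again share a row or a column, [r] is forced
    strictly southwest of [q], and a corner of the rectangle of [r] and [q] would have to be read
    between them, where only [p] stands. *)
Lemma reading_swap_after B f u v p q r :
  sw_convex B -> nw_increasing B f ->
  reading B (u ++ [:: r; p; q] ++ v) -> strictly_between (f p) (f q) (f r) ->
  reading_order q p.
Proof.
move=> Bc fB bB fr; rewrite /reading_order.
have [<-//|/eqP neq_qp] /= := eqVneq; apply/negP=> pq.
have [[rB pB qB] [+ _ _]] := reading_triple bB.
have bB' : reading B ((u ++ [:: r]) ++ p :: [::] ++ q :: v) by rewrite -catA.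
have bpq s := reading_between (s := s) bB'.
have brq s := reading_between (m := [:: p]) (v := v) (s := s) bB.
have le x y := @nw_increasing_le B f x y fB.
have corner x y s :
  x \in B -> y \in B -> southwest x s -> southwest s y -> s \in B.
  exact: Bc.
rewrite /reading_order; have [eq_pr|/eqP neq_pr /= nrq] := eqVneq r p.
  by move: fr; rewrite eq_pr /strictly_between; lia.
case: p q r => [i j] [i' j'] [k l]
  in pB qB rB bpq brq fr neq_qp pq neq_pr nrq {bB bB'} *.
rewrite /southwest /= in pq nrq bpq brq corner le.
have ij' : (i, j') \in B by apply: corner pB qB _ _ => /=; lia.
have := bpq _ ij'; rewrite !inE /= !xpair_eqE => bpq'.
have := le _ _ pB rB; have := le _ _ rB pB.
have := le _ _ qB rB; have := le _ _ rB qB.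
have := le _ _ pB qB; have := le _ _ qB pB => /=.
rewrite /strictly_between in fr.
have [eqi|neqi] := eqVneq i i'.
- subst i'; have [lt_ik|] := ltnP i k; last by lia.
  have [le_lj|] := leqP l j'; last by lia.
  have kj' : (k, j') \in B by apply: corner rB qB _ _ => /=; lia.
  by have := brq _ kj'; rewrite !inE /= !xpair_eqE; lia.
- have eqj : j = j' by lia.
  subst j'; have [lt_lj|] := ltnP l j; last by lia.
  have [le_ik|] := leqP i' k; last by lia.
  have il : (i', l) \in B by apply: corner rB qB _ _ => /=; lia.
  by have := brq _ il; rewrite !inE /= !xpair_eqE; lia.
Qed.

Lemma reading_pair B u m v p r :
  reading B (u ++ p :: m ++ r :: v) ->
  [/\ p \in B, r \in B & reading_order p r].
Proof.
case=> memB; rewrite pairwise_cat pairwise_cons all_cat /=.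
case/and3P=> _ _ /andP[/and3P[_ -> _] _].
by rewrite -!memB !(mem_cat, inE) !eqxx !orbT.
Qed.

(** Equal values exclude northwest position, so distinct [p] and [r] would span a nondegenerate
    rectangle. Both of its other corners would have to be read in [m], which has room for one
    box. *)
Lemma reading_repeat B f u m v p r :
  sw_convex B -> nw_increasing B f ->
  reading B (u ++ p :: m ++ r :: v) -> size m <= 1 -> f p = f r -> p = r.
Proof.
move=> Bc fB bB le_m1 eqf; apply/eqP/negP=> /negP neq_pr.
have between s := reading_between (s := s) bB.
have [pB rB Rpr] := reading_pair bB.
have lt := fB _ _ pB rB (elimN eqP neq_pr).
have gt := fB _ _ rB pB (nesym (elimN eqP neq_pr)).
have pr : southwest p r.
  move: Rpr; rewrite /reading_order (negPf neq_pr) /= /southwest.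
  by rewrite /northwest in lt gt; lia.
have corner s : southwest p s -> southwest s r -> s \in B by apply: Bc pB rB.
case: p r => [i j] [i' j']
  in pB rB eqf neq_pr between Rpr lt gt pr corner {bB} *.
rewrite /southwest /northwest /= in pr between corner lt gt.
rewrite xpair_eqE in neq_pr.
have := between (i, j') (corner _ _ _); have := between (i', j) (corner _ _ _).
rewrite !inE !mem_rcons !inE !xpair_eqE /=.
case: m {between} le_m1 => [|[k l] [|//]] _; rewrite ?inE ?xpair_eqE; lia.
Qed.

(** * Readable words are closed under K-Knuth moves *)

Lemma reading_swap B u v p q :
  reading_order q p -> reading B (u ++ p :: q :: v) ->
  reading B (u ++ q :: p :: v).
Proof.
move=> Rqp [memB /(pairwise_swap Rqp) Rb]; split=> // s.
by rewrite -memB !(mem_cat, inE) [(s == q) || _]orbCA.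
Qed.

Lemma reading_order_refl p : reading_order p p.
Proof. by rewrite /reading_order eqxx. Qed.

Lemma reading_dup B u v p :
  reading B (u ++ p :: v) <-> reading B (u ++ p :: p :: v).
Proof.
rewrite /reading; have -> : pairwise reading_order (u ++ p :: p :: v) =
                            pairwise reading_order (u ++ p :: v).
  rewrite !pairwise_cat !allrel_consr /= reading_order_refl /=.
  by case: (all _ u); case: (all _ v).
have eqm : u ++ p :: p :: v =i u ++ p :: v.
  by move=> s; rewrite !(mem_cat, inE); case: (s == p).
by split=> -[memB Rb]; split=> // s; rewrite -memB eqm.
Qed.

(** Both orders of [p] and [q] occur, so the two boxes commute: [pqp] becomes [qpp], [qp], [qqp] and
    finally [qpq]. *)
Lemma reading_braid B u v p q :
  reading B (u ++ p :: q :: p :: v) -> reading B (u ++ q :: p :: q :: v).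
Proof.
move=> bB; have [_ [Rpq _ Rqp]] :=
  reading_triple (bB : reading B (u ++ [:: p; q; p] ++ v)).
move: bB => /(reading_swap Rqp); rewrite -cat_rcons.
move/(iffRL (reading_dup _ _ _ _)).
rewrite cat_rcons => /(iffLR (reading_dup _ _ _ _)).
by rewrite -cat_rcons => /(reading_swap Rpq); rewrite cat_rcons.
Qed.

Lemma map_eq_cat (f : box -> nat) b u v :
  map f b = u ++ v ->
  exists bu bv, [/\ b = bu ++ bv, map f bu = u & map f bv = v].
Proof.
move=> eq_b; exists (take (size u) b), (drop (size u) b).
by rewrite cat_take_drop map_take map_drop eq_b take_size_cat ?drop_size_cat.
Qed.

Lemma map_eq_cat3 (f : box -> nat) b u x y z v :
  map f b = u ++ [:: x; y; z] ++ v ->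
  exists bu bv p q r, [/\ b = bu ++ [:: p; q; r] ++ bv, map f bu = u,
    [/\ f p = x, f q = y & f r = z] & map f bv = v].
Proof.
case/map_eq_cat=> bu [[|p [|q [|r bv]]] [-> <-]] //= [<- <- <- <-].
by exists bu, bv, p, q, r.
Qed.

(** Each move lifts from letters to boxes. A Knuth move swaps two adjacent boxes; for merging and
    braiding, [reading_repeat] first shows that the equal letters come from one box. *)
Lemma readable_step B f w w' :
  sw_convex B -> nw_increasing B f -> kknuth_step w w' ->
  readable B f w <-> readable B f w'.
Proof.
move=> Bc fB; case=> {w w'} [u v x y z xy yz|u v x y z xy yz|u v x|u v x y].
- have step a c : strictly_between a c y ->
      readable B f (u ++ [:: a; c; y] ++ v) ->
      readable B f (u ++ [:: c; a; y] ++ v).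
    move=> ac [b bB /map_eq_cat3[bu [bv [p [q [r]]]]]].
    case=> eqb eqbu [eqa eqc eqy] eqbv; rewrite -eqa -eqc -eqy in ac.
    rewrite eqb in bB; have Rqp := reading_swap_before Bc fB bB ac.
    exists (bu ++ [:: q; p; r] ++ bv); first exact: reading_swap bB.
    by rewrite !map_cat /= eqbu eqbv eqa eqc eqy.
  by split; apply: step; rewrite /strictly_between xy yz ?orbT.
- have step a c : strictly_between a c y ->
      readable B f (u ++ [:: y; a; c] ++ v) ->
      readable B f (u ++ [:: y; c; a] ++ v).
    move=> ac [b bB /map_eq_cat3[bu [bv [r [p [q]]]]]].
    case=> eqb eqbu [eqy eqa eqc] eqbv; rewrite -eqa -eqc -eqy in ac.
    rewrite eqb in bB; have Rqp := reading_swap_after Bc fB bB ac.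
    exists (bu ++ [:: r; q; p] ++ bv).
      by move: bB; rewrite /= -!(cat_rcons r); apply: reading_swap.
    by rewrite !map_cat /= eqbu eqbv eqa eqc eqy.
  by split; apply: step; rewrite /strictly_between xy yz ?orbT.
- split=> -[b bB /map_eq_cat[bu [[|p bv] [eqb eqbu]]]] //=.
  + move=> [eqx eqbv]; exists (bu ++ p :: p :: bv).
      by apply/(iffLR (reading_dup _ _ _ _)); rewrite -eqb.
    by rewrite map_cat /= eqbu eqx eqbv.
  + case: bv eqb => [|q bv] eqb //= [eqx eqx' eqbv].
    rewrite eqb in bB.
    have eqpq : p = q.
      by apply: (reading_repeat (m := [::]) Bc fB bB) => //; rewrite eqx.
    exists (bu ++ p :: bv).
      by apply/(iffRL (reading_dup _ _ _ _)); rewrite {2}eqpq.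
    by rewrite map_cat /= eqbu eqx eqbv.
- have step a c : readable B f (u ++ [:: a; c; a] ++ v) ->
                  readable B f (u ++ [:: c; a; c] ++ v).
    move=> [b bB /map_eq_cat3[bu [bv [p [q [r]]]]]].
    case=> eqb eqbu [eqa eqc eqa'] eqbv; rewrite eqb in bB.
    have eqpr : p = r.
      by apply: (reading_repeat (m := [:: q]) Bc fB bB) => //; rewrite eqa.
    exists (bu ++ [:: q; p; q] ++ bv).
      by rewrite -eqpr in bB; apply: reading_braid bB.
    by rewrite !map_cat /= eqbu eqbv eqa eqc.
  by split; apply: step.
Qed.

Lemma readable_kknuth B f w w' :
  sw_convex B -> nw_increasing B f -> kknuth_word w w' ->
  readable B f w <-> readable B f w'.
Proof.
move=> Bc fB.
elim=> {w w'} [w w' /readable_step|w|w w' _ IH|w1 w2 w3 _ -> _ ->] //.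
- exact.
- by split; case: IH.
Qed.

(** * Right-aligned shapes and the recovery of their rows from a reading *)

Definition staircase (l : nat -> nat) (N i n : nat) : pred box :=
  [pred p : box | (i <= p.1 < i + n) && (l p.1 < p.2 <= N)].

Definition staircase_row (l : nat -> nat) (N a : nat) : seq box :=
  [seq (a, c) | c <- iota (l a).+1 (N - l a)].

Lemma mem_staircase_row l N a (p : box) :
  (p \in staircase_row l N a) = (p.1 == a) && (l a < p.2 <= N).
Proof.
case: p => b c; apply/mapP/idP=> [[k] | /= /andP[/eqP -> lc]].
  by rewrite mem_iota => lk [-> ->] /=; lia.
by exists c => //; rewrite mem_iota; lia.
Qed.

(** Column-strictness weakened to a condition free of column indices, since the columns of the
    unknown tableau are not yet tied to those of the staircase. *)
Definition below_row (r r' : seq nat) : bool :=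
  all (fun x => has (fun y => y < x) r) r'.

Lemma sorted_map_iota (g : nat -> nat) m k :
  (forall c d, m <= c -> c < d -> d < m + k -> g c < g d) ->
  sorted ltn (map g (iota m k)).
Proof.
move=> g_lt; apply: (homo_sorted_in (P := [pred c | m <= c < m + k])
  _ _ (iota_ltn_sorted m k)).
  by move=> c d /andP[mc _] /andP[_ dk] cd; apply: g_lt.
by apply/allP=> c; rewrite mem_iota.
Qed.

Lemma staircase_rows_unique f l N n i rs :
  (forall a c, i <= a <= c -> c < i + n -> l a <= l c) ->
  (forall a, i <= a < i + n -> l a < N) ->
  nw_increasing (staircase l N i n) f ->
  all (sorted ltn) rs -> [::] \notin rs -> pairwise below_row rs ->
  readable (staircase l N i n) f (flatten (rev rs)) ->
  rs = [seq map f (staircase_row l N a) | a <- iota i n].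
Proof.
elim: n i rs => [|n IH] i rs l_le l_lt fB rs_lt rs0 rs_below [b [memB Rb] eq_b].
  case: b memB eq_b {Rb} => [_|p b /(_ p)]; last by rewrite !inE eqxx; lia.
  by case: rs rs0 {rs_lt rs_below} => // -[|x r] rs;
    rewrite // rev_cons flatten_rcons; case: flatten.
case: rs rs_lt rs0 rs_below eq_b => [|r rs] /=.
  have : (i, N) \in b by rewrite memB !inE /= l_lt; lia.
  by case: b {memB Rb}.
rewrite inE negb_or => /andP[r_lt rs_lt] /andP[r0 rs0] /andP[r_below rs_below].
rewrite rev_cons flatten_rcons => /map_eq_cat[b' [s [eq_b eq_b' eq_s]]].
have Bb (p : box) : p \in b -> (i <= p.1 < i + n.+1) && (l p.1 < p.2 <= N).
  by rewrite memB inE.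
have [s0 [q eq_sq]] : exists s0 q, s = rcons s0 q.
  by case/lastP: s eq_s {eq_b} => [eq_r|s0 q _];
    [rewrite -eq_r in r0 | exists s0, q].
have r_pw : pairwise ltn r by rewrite -sorted_pairwise //; exact: ltn_trans.
have qb : q \in b by rewrite eq_b eq_sq mem_cat mem_rcons inE eqxx orbT.
(* Every box is weakly southwest of [(i, N)], so only [(i, N)] can be read last. *)
have q1 : q.1 = i.
  have iNb : (i, N) \in b by rewrite memB inE /= l_lt; lia.
  move: (iNb); rewrite eq_b eq_sq -cats1 catA mem_cat mem_seq1.
  case/orP=> [iNb'|/eqP <- //].
  move: Rb; rewrite eq_b eq_sq -cats1 catA pairwise_cat.
  case/and3P=> /allrelP/(_ _ _ iNb' (mem_head _ _)) + _ _.
  rewrite /reading_order.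
  case/orP=> [/eqP <- //|]; rewrite /southwest /=.
  by have := Bb _ qb; lia.
(* A box [p] of [s] below row [i] has a smaller value above it at [(i, p.2)]. Either [q] is weakly
   northwest of [p], so that [f q <= f p], or [(i, p.2)] is read after [p] within [s]; both
   contradict that [r] increases. *)
have s1 (p : box) : p \in s -> p.1 = i.
  rewrite eq_sq mem_rcons inE => /orP[/eqP -> //|p_s0].
  have pb : p \in b by rewrite eq_b eq_sq mem_cat mem_rcons inE p_s0 !orbT.
  have Bp := Bb _ pb; have pB : p \in staircase l N i n.+1 by rewrite -memB.
  apply/eqP; apply: contraT => neq_p1.
  have iB : (i, p.2) \in staircase l N i n.+1.
    by move: Bp (l_le i p.1); rewrite inE /=; clear; lia.
  have lt_corner : f (i, p.2) < f p.
    apply: (fB _ _ iB pB); first by move=> eqp; rewrite -eqp eqxx in neq_p1.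
    split; last exact: leqnn.
    by case/andP: Bp => /andP[].
  have [le_qp|lt_pq] := leqP q.2 p.2.
    have le_f : f q <= f p.
      apply: (nw_increasing_le fB _ pB _ le_qp); first by rewrite -memB.
      by rewrite q1; case/andP: Bp => /andP[].
    move: r_pw; rewrite -eq_s eq_sq map_rcons -cats1 pairwise_cat.
    case/and3P=> /allrelP/(_ _ _ (map_f f p_s0) (mem_head _ _)) /= + _ _.
    by rewrite ltnNge le_f.
  case/splitPr: p_s0 eq_sq => s1 s2 eq_sq.
  have : (i, p.2) \in p :: rcons s2 q.
    apply: (@reading_between (staircase l N i n.+1) (b' ++ s1) s2 [::]) => //.
    - by split=> //; rewrite -?catA;
        move: Rb memB; rewrite eq_b eq_sq rcons_cat /= cats1.
    - by rewrite /southwest /= leqnn andbT; case/andP: Bp => /andP[].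
    - by rewrite /southwest /= q1 leqnn ltnW.
  rewrite inE => /orP[/eqP eqp|in_s2]; first by rewrite -eqp /= eqxx in neq_p1.
  move: r_pw; rewrite -eq_s eq_sq rcons_cat map_cat pairwise_cat /=.
  case/and4P=> _ _ /allP/(_ _ (map_f f in_s2)) /= + _.
  by rewrite ltnNge ltnW.
(* The value of [p] lies in a later list of [rs], so some [p'] in [s], hence in row [i], has a
   smaller value. If [p] were in row [i] too, being read before [p'] would put it to the left of
   [p'], and [f p <= f p']. *)
have b'1 (p : box) : p \in b' -> i < p.1.
  move=> pb'; have pb : p \in b by rewrite eq_b mem_cat pb'.
  have /flattenP[r' r'rs fp_r'] : f p \in flatten (rev rs).
    by rewrite -eq_b' map_f.
  rewrite mem_rev in r'rs.
  have /hasP[y] := allP (allP r_below _ r'rs) _ fp_r'.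
  rewrite -eq_s => /mapP[p' p's ->] lt_f.
  have p'1 := s1 _ p's; have p'b : p' \in b by rewrite eq_b mem_cat p's orbT.
  move: Rb; rewrite eq_b pairwise_cat => /and3P[/allrelP/(_ _ _ pb' p's) + _ _].
  rewrite /reading_order => /orP[/eqP eqp|]; first by rewrite eqp ltnn in lt_f.
  rewrite /southwest p'1 => nsw; have /andP[/andP[le_ip _] _] := Bb _ pb.
  rewrite ltn_neqAle le_ip andbT; apply: contraL lt_f => /eqP eqp1.
  rewrite -eqp1 leqnn /= -ltnNge in nsw; rewrite -leqNgt.
  apply: (nw_increasing_le fB _ _ _ (ltnW nsw)); rewrite -?memB //.
  by rewrite p'1 eqp1.
have s_row : s =i staircase_row l N i.
  move=> p; rewrite mem_staircase_row; apply/idP/idP=> [ps|/andP[/eqP p1 p2]].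
    have /andP[_] : (i <= p.1 < i + n.+1) && (l p.1 < p.2 <= N).
      by apply: Bb; rewrite eq_b mem_cat ps orbT.
    by rewrite s1 // eqxx.
  have : p \in b by rewrite memB inE p1 p2 leqnn addnS ltnS leq_addr.
  by rewrite eq_b mem_cat => /orP[/b'1|//]; rewrite p1 ltnn.
congr (_ :: _).
  (* Two strictly increasing lists with the same elements coincide. *)
  apply: (irr_sorted_eq ltn_trans ltnn) => //.
  - rewrite -map_comp; apply: sorted_map_iota => c d c_le cd d_lt.
    apply: fB; rewrite ?inE /=; [lia|lia| |by split=> //=; lia].
    by case; lia.
  - by rewrite -eq_s; apply: eq_mem_map.
apply: IH => //.
- by move=> a c /andP[/ltnW ia ac] cn; apply: l_le; rewrite ?ia // addnS -addSn.
- by move=> a /andP[/ltnW ia an]; apply: l_lt; rewrite ia addnS -addSn.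
- move=> p1 p2; rewrite !inE addSnnS.
  move=> /andP[/andP[/ltnW h1 h2] h3] /andP[/andP[/ltnW h4 h5] h6].
  by apply: fB; rewrite inE ?h1 ?h2 ?h3 ?h4 ?h5 ?h6.
exists b' => //; split; last by move: Rb; rewrite eq_b pairwise_cat => /and3P[].
move=> p; rewrite inE addSnnS; apply/idP/idP=> [pb'|/andP[/andP[ip pn] Hp]].
  have /andP[/andP[_ ->] ->] : (i <= p.1 < i + n.+1) && (l p.1 < p.2 <= N).
    by apply: Bb; rewrite eq_b mem_cat pb'.
  by rewrite b'1.
have : p \in b by rewrite memB inE (ltnW ip) pn.
by rewrite eq_b mem_cat => /orP[//|/s1 p1]; rewrite p1 ltnn in ip.
Qed.

(** * Row lengths and row counts of straight shapes *)

Lemma row_length_gt (s : shape) i j :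
  straight s -> 0 < i -> 0 < j -> ((i, j) \in s) = (j <= row_length s i).
Proof.
move=> [s_box s_down] i0 j0; apply/idP/idP=> [ijs|].
  (* A row of a straight shape is an initial segment, so its cardinality is its last column: it
     contains columns 1 to [j], or else fits into columns 1 to [j.-1]. *)
  rewrite -[leqLHS](size_iota 1) -(size_map (pair i)).
  apply: uniq_leq_size; first by rewrite map_inj_uniq ?iota_uniq // => ? ? [].
  move=> _ /mapP[k + ->]; rewrite mem_iota => kj; rewrite !inE /= eqxx andbT.
  by apply: s_down ijs _; [|]; split=> //=; lia.
apply: contraLR => ijs; rewrite -ltnNge.
rewrite -(prednK j0) ltnS -[leqRHS](size_iota 1) -(size_map (pair i)).
apply: uniq_leq_size; first exact: fset_uniq.
move=> [a k]; rewrite !inE /= => /andP[aks /eqP eq_a]; rewrite eq_a in aks.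
apply/mapP; exists k; last by rewrite eq_a.
have [_ k0] := s_box _ aks; rewrite /= in k0; rewrite mem_iota.
have [|] := ltnP k j; first by lia.
by move=> jk; case/negP: ijs; apply: s_down aks _; split=> /=.
Qed.

Lemma nrows_gt (s : shape) i :
  straight s -> 0 < i -> ((i, 1) \in s) = (i <= nrows s).
Proof.
move=> [s_box s_down] i0; apply/idP/idP=> [i1s|].
  rewrite -[leqLHS](size_iota 1).
  apply: uniq_leq_size; first exact: iota_uniq.
  move=> k; rewrite mem_iota => ki; apply/imfsetP; exists (k, 1) => //=.
  by apply: s_down i1s _; [|]; split=> //=; lia.
apply: contraLR => i1s; rewrite -ltnNge.
rewrite -(prednK i0) ltnS -[leqRHS](size_iota 1).
apply: uniq_leq_size; first exact: fset_uniq.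
move=> _ /imfsetP[[k c] /= kcs ->].
have [/= k0 c0] := s_box _ kcs; rewrite mem_iota.
have [|] := ltnP k i; first by lia.
by move=> ik; case/negP: i1s; apply: s_down kcs _; split=> /=.
Qed.

Lemma row_length_le (s : shape) a c :
  straight s -> 0 < a -> a <= c -> row_length s c <= row_length s a.
Proof.
move=> ss a0 ac; case: (posnP (row_length s c)) => [-> //|c0].
have cs : (c, row_length s c) \in s by rewrite row_length_gt // (leq_trans a0).
by rewrite -row_length_gt //; apply: (proj2 ss) cs _; split.
Qed.

Lemma row_length_gt0 (s : shape) a :
  straight s -> 0 < a -> (0 < row_length s a) = (a <= nrows s).
Proof. by move=> ss a0; rewrite -row_length_gt // nrows_gt. Qed.

Lemma mem_straight (s : shape) (p : box) : straight s ->
  (p \in s) = (0 < p.1) && (0 < p.2 <= row_length s p.1).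
Proof.
case: p => i j ss; apply/idP/idP=> [ps|/and3P[/= i0 j0 js]].
  by have [/= i0 j0] := proj1 ss _ ps; rewrite i0 j0 -row_length_gt.
by rewrite row_length_gt.
Qed.

(** * Tableaux as lists of rows, from the top row down *)

Definition tableau_rows (T : filling) : seq (seq nat) :=
  [seq [seq entry T (i, j) | j <- iota 1 (row_length (domf T) i)]
  | i <- iota 1 (nrows (domf T))].

Lemma row_wordE T : row_word T = flatten (rev (tableau_rows T)).
Proof. by rewrite /row_word /tableau_rows map_rev. Qed.

Lemma tableau_rows_inj T T' : straight (domf T) -> straight (domf T') ->
  tableau_rows T = tableau_rows T' -> T = T'.
Proof.
move=> sT sT' eq_rows.
have eq_n : nrows (domf T) = nrows (domf T').
  by have := congr1 size eq_rows; rewrite !size_map !size_iota.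
have eq_row i : 0 < i <= nrows (domf T) ->
    [seq entry T (i, j) | j <- iota 1 (row_length (domf T) i)] =
    [seq entry T' (i, j) | j <- iota 1 (row_length (domf T') i)].
  move=> /andP[i0 i_n]; have := congr1 (nth [::] ^~ i.-1) eq_rows.
  by rewrite !(nth_map 0) ?size_iota -?eq_n ?prednK // !nth_iota -?eq_n ?prednK //
             add1n prednK.
(* Past the last row both lengths are 0. *)
have eq_len i : 0 < i -> row_length (domf T) i = row_length (domf T') i.
  move=> i0; have [i_n|n_i] := leqP i (nrows (domf T)).
    by have := congr1 size (eq_row i _); rewrite !size_map !size_iota i0; apply.
  have := row_length_gt0 sT i0; have := row_length_gt0 sT' i0.
  by rewrite -eq_n; lia.
have eq_dom p : (p \in domf T) = (p \in domf T').
  by rewrite !mem_straight //; case: posnP => // p0; rewrite eq_len.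
apply/fmapP=> p; have [pT|pT] := boolP (p \in domf T); last first.
  by rewrite !not_fnd // -eq_dom.
have pT' : p \in domf T' by rewrite -eq_dom.
suff : entry T p = entry T' p by rewrite /entry !in_fnd /= => ->.
case: p pT {pT'} => i j; rewrite mem_straight // => /and3P[/= i0 j0 jT].
have i_n : i <= nrows (domf T) by rewrite -row_length_gt0 // (leq_trans j0).
have := congr1 (nth 0 ^~ j.-1) (eq_row i _); rewrite i0 => /(_ i_n) /=.
by rewrite !(nth_map 0) ?size_iota -?eq_len ?prednK // !nth_iota -?eq_len ?prednK //
           add1n prednK.
Qed.

Lemma pairwise_map_iota (S : Type) (R : rel S) (g : nat -> S) m k :
  (forall c d, m <= c -> c < d -> d < m + k -> R (g c) (g d)) ->
  pairwise R (map g (iota m k)).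
Proof.
move=> gR; rewrite pairwise_map.
apply: (sub_in_pairwise (P := [pred c | m <= c < m + k]) (r := ltn)).
- by move=> c d /andP[mc _] /andP[_ dk] cd; apply: gR.
- by apply/allP=> c; rewrite mem_iota.
- by rewrite -(sorted_pairwise ltn_trans) iota_ltn_sorted.
Qed.

Lemma tableau_rows_sorted T : tableau T -> all (sorted ltn) (tableau_rows T).
Proof.
move=> [sT [_ T_lt]]; apply/allP=> _ /mapP[i + ->]; rewrite mem_iota => i_n.
apply: sorted_map_iota => c d c0 cd dT; apply: T_lt.
- by rewrite mem_straight //=; lia.
- by rewrite mem_straight //=; lia.
- by case; lia.
- by split=> //=; lia.
Qed.

Lemma tableau_rows_nonempty T :
  tableau T -> [::] \notin tableau_rows T.
Proof.
move=> [sT _]; apply/mapP=> -[i]; rewrite mem_iota add1n ltnS => /andP[i0 i_n].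
move/(congr1 size); rewrite size_map size_iota => eq0.
by move: i_n; rewrite -row_length_gt0 // -eq0.
Qed.

Lemma tableau_rows_below T : tableau T -> pairwise below_row (tableau_rows T).
Proof.
move=> [sT [_ T_lt]]; apply: pairwise_map_iota => c d c0 cd _.
apply/allP=> _ /mapP[j + ->]; rewrite mem_iota => j_d.
have le_len := row_length_le sT c0 (ltnW cd).
apply/hasP; exists (entry T (c, j)).
  by apply: map_f; rewrite mem_iota; lia.
apply: T_lt.
- by rewrite mem_straight //=; lia.
- by rewrite mem_straight //=; lia.
- by case; lia.
- by split=> //=; lia.
Qed.

(** * The right alignment as a staircase *)

Lemma reading_staircase l N i n :
  reading (staircase l N i n)
    (flatten (rev [seq staircase_row l N a | a <- iota i n])).
Proof.
elim: n i => [|n IH] i /=; first by split=> // p; rewrite !inE; lia.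
rewrite rev_cons flatten_rcons; have [memB Rb] := IH i.+1.
split.
  move=> [a c]; rewrite mem_cat memB mem_staircase_row !inE /=.
  by case: (eqVneq a i) => [->|]; lia.
rewrite pairwise_cat Rb /=; apply/andP; split.
  apply/allrelP=> -[a c] [a' c']; rewrite memB mem_staircase_row inE /=.
  move=> ia ia'.
  by rewrite /reading_order /southwest /=; apply/orP; right; lia.
apply: pairwise_map_iota => c d _ cd _.
by rewrite /reading_order /southwest /= leqnn leqNgt cd orbT.
Qed.

(** A box between [p] and [q] is no lower than [p], so its left margin is at most that of [p]; the
    right border [N] is common to all rows. *)
Lemma sw_convex_staircase l N i n :
  (forall a c, i <= a <= c -> c < i + n -> l a <= l c) ->
  sw_convex (staircase l N i n).
Proof.
move=> l_le p q r; rewrite !inE /southwest => pB qB pr rq.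
by have := l_le r.1 p.1; lia.
Qed.

Lemma mem_right_shape (s : shape) : straight s ->
  right_shape s =i staircase (fun a => row_length s 1 - row_length s a)
                             (row_length s 1) 1 (nrows s).
Proof.
(* No row exceeds the first, so the truncated subtraction is exact and every row ends in column
   [row_length s 1]. *)
move=> ss [i j]; have le_len := row_length_le (c := i) ss (ltn0Sn 0).
rewrite !inE /=; apply/allpairsPdep/idP=> /= [[a [c []]]|ij].
  by rewrite !mem_iota => a_n c_a [eqi eqj]; subst; lia.
by exists i, j; rewrite !mem_iota; split=> //; lia.
Qed.

Lemma entry_right_alignment (T : filling) b :
  b \in right_shape (domf T) ->
  entry (right_alignment T) b =
  entry T (b.1, b.2 + row_length (domf T) b.1 - row_length (domf T) 1).
Proof. by move=> bT; rewrite {1}/entry in_fnd /= ffunE. Qed.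

Theorem theorem5p3 (T : filling) (hT : tableau T) (hR : right_alignable T) :
  URT T.
Proof.
have sT := proj1 hT; split=> // T' hT' eqT'.
pose N := row_length (domf T) 1; pose n := nrows (domf T).
pose l a := N - row_length (domf T) a.
pose f := entry (right_alignment T).
have memB : right_shape (domf T) =i staircase l N 1 n := mem_right_shape sT.
have l_le a c : 1 <= a <= c -> c < 1 + n -> l a <= l c.
  by move=> /andP[a0 ac] _; apply: leq_sub2l; apply: row_length_le.
have l_lt a : 1 <= a < 1 + n -> l a < N.
  rewrite add1n ltnS => /andP[a0 a_n].
  have := row_length_le sT (ltn0Sn 0) a0; move: a_n.
  by rewrite -row_length_gt0 // /l /N; lia.
have fB : nw_increasing (staircase l N 1 n) f.
  by move=> p q pB qB; apply: (proj2 hR); rewrite /= memB.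
have rowsT : tableau_rows T = [seq map f (staircase_row l N a) | a <- iota 1 n].
  rewrite /tableau_rows; apply/eq_in_map=> a.
  rewrite mem_iota add1n ltnS => /andP[a0 a_n].
  have le_a := row_length_le sT (ltn0Sn 0) a0.
  rewrite /staircase_row -map_comp /l subKn //.
  (* Column [j] of row [a] of [T] sits in column [l a + j] of the alignment. *)
  rewrite -(addn1 (N - _)) iotaDl -map_comp.
  apply/eq_in_map=> j; rewrite mem_iota => ja /=.
  rewrite /f entry_right_alignment /=.
    by congr (entry T (_, _)); rewrite /N; lia.
  by rewrite memB inE /= /l /N; lia.
have readT : readable (staircase l N 1 n) f (row_word T).
  exists (flatten (rev [seq staircase_row l N a | a <- iota 1 n])).
    exact: reading_staircase.
  by rewrite map_flatten map_rev -map_comp row_wordE rowsT.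
(* Readability passes along [eqT'] from the row word of [T] to that of [T'], and the staircase then
   dictates the rows of [T']. *)
apply: tableau_rows_inj (proj1 hT') sT _; rewrite rowsT.
apply: staircase_rows_unique => //.
- exact: tableau_rows_sorted.
- exact: tableau_rows_nonempty.
- exact: tableau_rows_below.
rewrite -row_wordE.
exact/(readable_kknuth (sw_convex_staircase l_le) fB eqT').
Qed.
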